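(* Let $L=\{\frac{a}{b}\}$, where $\frac{a}{b}$ is a positive irreducible fraction less than $1$ and $b$ is a prime. Let $\mathcal{F}$ be a fractional $L$-intersecting family of subspaces of a vector space $V$ of dimension $n$ over a finite field of size $q$. Then $|\mathcal{F}|\le (b-1)\left(\binom{n}{1}_q+1\right)\left\lceil\frac{\ln n}{\ln b}\right\rceil+2$.
   Context: A family $\mathcal{F}=\{V_1,\ldots,V_m\}$ of subspaces of $V$ is a fractional $L$-intersecting family of subspaces if for every two distinct $i,j\in[m]$, $\frac{\dim(V_i\cap V_j)}{\dim(V_i)}\in L$ or $\frac{\dim(V_i\cap V_j)}{\dim(V_j)}\in L$. $\binom{n}{1}_q=\frac{q^n-1}{q-1}$ is the number of $1$-dimensional subspaces of $V$. *)

(* Defs.v *)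
From mathcomp Require Import all_boot all_order all_algebra.
From mathcomp Require Import finmap reals exp.

Set Implicit Arguments.
Unset Strict Implicit.
Unset Printing Implicit Defensive.

Import GRing.Theory Num.Theory.
Local Open Scope ring_scope.

(* If U is the zero subspace this is 0 / 0, which evaluates to 0; that value
   never lies in a set L of positive fractions. *)
Definition dim_ratio (K : fieldType) (V : vectType K) (W U : {vspace V}) : rat :=
  (\dim W)%:R / (\dim U)%:R.

Definition fractional_intersecting (K : fieldType) (V : vectType K)
    (L : {pred rat}) (Fam : {fset {vspace V}}) : Prop :=
  forall U W : {vspace V}, U \in Fam -> W \in Fam -> U != W ->
    dim_ratio (U :&: W)%VS U \in L \/ dim_ratio (U :&: W)%VS W \in L.

(* The q-binomial coefficient [n choose 1]_q. *)
Definition qbinom1 (R : fieldType) (q n : nat) : R :=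
  (q%:R ^+ n - 1) / (q%:R - 1).

(* Main.v *)
Require Import Defs.
From mathcomp Require Import all_boot all_order all_algebra all_field.
From mathcomp Require Import finmap reals exp.

Set Implicit Arguments.
Unset Strict Implicit.
Unset Printing Implicit Defensive.

Import Order.TTheory GRing.Theory Num.Theory.

(* Two distinct members cannot both have dimension 0 or prime to b.  The other
   members are sorted by the valuation k + 1 of their dimension at b and by the
   residue j of its cofactor.  Inside a class, put d = b^k and Q = q^d: the
   incidence vectors of the projective points of the members have inner products
   [dim (U :&: W)]_q = [d]_q * [x]_Q.  For a prime p dividing [b]_Q, [x]_Q is 0
   mod p when U = W, and a fixed unit [a * j]_Q otherwise.  So the Gram matrix
   divided by [d]_q and shifted by a rank-one matrix is a nonzero scalar matrix
   mod p, and the size of the class is at most the number of points plus one. *)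

(** * Arithmetic of q-integers *)

(** The q-integer $[k]_q = (q^k - 1)/(q - 1)$, kept as a sum so as to stay in [nat]. *)
Definition qnum (q k : nat) : nat := \sum_(i < k) q ^ i.

Lemma qnumD q k l : qnum q (k + l) = qnum q k + q ^ k * qnum q l.
Proof.
rewrite /qnum big_split_ord /= big_distrr /=; congr (_ + _).
by apply: eq_bigr => i _; rewrite expnD.
Qed.

(** The [d * x] powers of [q] split into [x] blocks of length [d], each a power of [q ^ d] times
    $[d]_q$. *)
Lemma qnumM q d x : qnum q (d * x) = qnum q d * qnum (q ^ d) x.
Proof.
elim: x => [|x IHx]; first by rewrite muln0 /qnum !big_ord0 muln0.
rewrite mulnS addnC qnumD IHx -(addn1 x) qnumD mulnDr expnM.
by rewrite [qnum _ 1]big_ord1 expn0 muln1 [_ * qnum q d]mulnC.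
Qed.

Lemma qnum_gt0 q k : 0 < k -> 0 < qnum q k.
Proof. by case: k => // k _; rewrite /qnum big_ord_recl. Qed.

Lemma qnum_gt1 q k : 0 < q -> 1 < k -> 1 < qnum q k.
Proof.
case: k => [|[|k]] // q_gt0 _; rewrite /qnum !big_ord_recl expn0.
by rewrite -[1.+1]/(1 + 1) leq_add2l addn_gt0 expn_gt0 q_gt0.
Qed.

Lemma dvdn_qnum q d k : d %| k -> qnum q d %| qnum q k.
Proof. by case/dvdnP=> x ->; rewrite mulnC qnumM dvdn_mulr. Qed.

Lemma qnum_modn q b x y : x = y %[mod b] -> qnum q x = qnum q y %[mod qnum q b].
Proof.
suff red z : qnum q z = qnum q (z %% b) %[mod qnum q b].
  by move=> exy; rewrite red exy -red.
rewrite {1}(divn_eq z b) addnC qnumD -modnDmr -modnMmr.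
by rewrite (eqP (dvdn_qnum _ (dvdn_mull _ (dvdnn b)))) muln0 mod0n addn0.
Qed.

(** A Bezout relation [u * x = v * y + 1] gives $[ux]_q = 1 + q[vy]_q$, so a common divisor of
    $[x]_q$ and $[y]_q$ divides 1. *)
Lemma coprime_qnum q x y : 0 < x -> coprime x y -> coprime (qnum q x) (qnum q y).
Proof.
move=> x_gt0 /(coprimeP _ x_gt0)[[u v] /= uv].
have {uv}uE : u * x = v * y + 1 by rewrite -uv subnKC // ltnW // -subn_gt0 uv.
set g := gcdn (qnum q x) (qnum q y); rewrite /coprime -/g -dvdn1.
have gx : g %| qnum q (u * x).
  exact: dvdn_trans (dvdn_gcdl _ _) (dvdn_qnum _ (dvdn_mull _ _)).
have gy : g %| qnum q (v * y).
  exact: dvdn_trans (dvdn_gcdr _ _) (dvdn_qnum _ (dvdn_mull _ _)).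
rewrite uE addnC qnumD [qnum _ 1]big_ord1 expn0 in gx.
by rewrite dvdn_addl in gx => //; apply: dvdn_mull.
Qed.

(* V and finvect_type V are convertible only once the structure V is unpacked. *)
Lemma card_finvect (K : finFieldType) (V : vectType K) (U : {vspace V}) :
  #|[pred x : finvect_type V | (x : V) \in U]| = #|K| ^ \dim U.
Proof.
case: V U => T c U; pose T' : finType := finvect_type (Vector.Pack c).
by rewrite -[RHS](@card_vspace K T' c U); apply: eq_card.
Qed.

(** * Projective points of a subspace *)

Section Lines.
Variables (K : finFieldType) (V : vectType K).
Local Notation T := (finvect_type V).

(* The 1-dimensional subspace spanned by x, without its origin. *)
Definition punctured_line (x : T) : {set T} :=
  [set (k *: x)%R | k : K in [set~ 0%R]].

Definition points (U : {vspace V}) : {set {set T}} :=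
  punctured_line @: [set x : T | (x != 0%R) && ((x : V) \in U)].

Lemma mem_points U x : x != 0%R ->
  (punctured_line x \in points U) = ((x : V) \in U).
Proof.
move=> x0; apply/imsetP/idP => [[y]|Ux]; last by exists x; rewrite // inE x0.
rewrite inE => /andP[_ Uy] exy.
have: x \in punctured_line x.
  by apply/imsetP; exists 1%R; rewrite ?scale1r // !inE oner_eq0.
by rewrite exy => /imsetP[k _ ->]; apply: memvZ.
Qed.

Lemma pointsI U W : points (U :&: W)%VS = points U :&: points W.
Proof.
apply/setP => B; rewrite inE.
have [/imsetP[x x0 ->]|nB] := boolP (B \in punctured_line @: [set~ 0%R]).
  by rewrite !inE in x0; rewrite !mem_points // memv_cap.
have nP X : B \in points X = false.
  apply: contraNF nB => /imsetP[x]; rewrite inE => /andP[x0 _] ->.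
  by apply/imset_f; rewrite !inE.
by rewrite !nP.
Qed.

(** Double counting: each point is the image of exactly [q.-1] of the [(q ^ \dim U).-1] nonzero
    vectors of [U]. *)
Lemma card_points U : #|points U| = qnum #|K| (\dim U).
Proof.
set q := #|K|; have q_gt1 : 1 < q := finNzRing_gt1 K.
set D := [set x : T | (x != 0%R) && ((x : V) \in U)].
have cD : #|D| = (q ^ \dim U).-1.
  rewrite -card_finvect [in RHS](cardD1 (0%R : T)) inE mem0v add1n /=.
  by apply: eq_card => x; rewrite !inE.
have: #|D| = #|points U| * q.-1.
  rewrite -sum1_card (partition_big_imset punctured_line) /= -sum_nat_const.
  apply: eq_bigr => _ /imsetP[x Dx ->].
  have x0 : x != 0%R by move: Dx; rewrite inE => /andP[].
  have -> : q.-1 = #|punctured_line x|.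
    rewrite card_imset ?cardsC1 // => k l /eqP.
    by rewrite -subr_eq0 -scalerBl scaler_eq0 (negPf x0) orbF subr_eq0 => /eqP.
  rewrite sum1dep_card; apply: eq_card => y; rewrite inE.
  apply/andP/idP => [[Dy /eqP <-]|/imsetP[k]].
    by apply/imsetP; exists 1%R; rewrite ?scale1r // !inE oner_eq0.
  rewrite !inE => k0 ->; move: Dx; rewrite !inE => /andP[_ Ux].
  rewrite scaler_eq0 negb_or k0 x0 memvZ //; split=> //; apply/eqP/setP => z.
  apply/imsetP/imsetP => -[l]; rewrite !inE => l0 ->.
    by exists (l * k)%R; rewrite ?scalerA // !inE mulf_neq0.
  by exists (l / k)%R; rewrite ?scalerA ?divfK // !inE mulf_neq0 ?invr_eq0.
rewrite cD predn_exp mulnC => /eqP; rewrite eqn_pmul2r -?subn1 ?subn_gt0 //.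
by move/eqP.
Qed.
End Lines.

(** * Rank bound for one class *)

(** The integer matrix with entries [g i j - s] is invertible over the rationals because its
    determinant is nonzero mod [p]. There it is also a Gram matrix divided by [c] plus a rank-one
    matrix. Dividing by [c] over the rationals allows [p] to divide [c]. *)
Lemma leq_card_inter_mod (T : finType) (S : {set T}) (m c p s : nat)
    (F : 'I_m -> {set T}) (g : 'I_m -> 'I_m -> nat) :
  prime p -> 0 < c -> ~~ (p %| s) -> (forall i, F i \subset S) ->
  (forall i j, #|F i :&: F j| = c * g i j) -> (forall i, p %| g i i) ->
  (forall i j, i != j -> g i j = s %[mod p]) -> m <= #|S|.+1.
Proof.
move=> p_pr c_gt0 ps FS cF gii gij.
pose B : 'M[int]_m := (\matrix_(i, j) ((g i j)%:R - s%:R))%R.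
have detB : (\det B)%R != 0%R.
  have: (\det (map_mx (intmul 1 : int -> 'F_p) B))%R != 0%R.
    (* Mod [p] the diagonal entries are [0 - s] and the others [s - s]. *)
    have -> : map_mx (intmul 1 : int -> 'F_p) B = ((- s%:R)%R%:M)%R.
      apply/matrixP => i j; rewrite !mxE rmorphB /= !mulrz_nat.
      have [<-|ij] := eqVneq i j; last first.
        by rewrite -Fp_nat_mod // gij // Fp_nat_mod // subrr.
      by rewrite mulr1n -Fp_nat_mod // (eqP (gii i)) sub0r.
    rewrite det_scalar expf_neq0 // oppr_eq0 -unitfE unitFpE //.
    by rewrite prime_coprime.
  by rewrite det_map_mx; apply: contraNneq => ->; rewrite rmorph0.
pose A : 'M[rat]_(m, #|S|) := (\matrix_(i, l) (enum_val l \in F i)%:R)%R.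
have AAT : (A *m A^T = \matrix_(i, j) (c%:R * (g i j)%:R))%R.
  apply/matrixP => i j; rewrite !mxE -natrM -cF.
  transitivity (\sum_(x in S) ((x \in F i) && (x \in F j))%:R : rat)%R.
    rewrite [RHS]big_enum_val /=; apply: eq_bigr => l _.
    by rewrite !mxE -natrM mulnb.
  rewrite -[in RHS]sum1_card natr_sum big_mkcond [RHS]big_mkcond /=.
  apply: eq_bigr => x _.
  rewrite inE; case: (boolP (x \in F i)) => [xF|] /=; last by case: ifP.
  by rewrite (subsetP (FS i)) //; case: ifP.
(* The shift is written as a column times a row, so its rank is at most 1; this is the extra one in
   the bound. *)
have BE : (map_mx (intmul 1 : int -> rat) B
    = c%:R^-1 *: (A *m A^T) + const_mx (- s%:R) *m const_mx (n := m) (m := 1) 1)%R.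
  apply/matrixP => i j; rewrite AAT !mxE big_ord1 !mxE mulr1 rmorphB /=.
  by rewrite !mulrz_nat mulKf // pnatr_eq0 -lt0n.
have <- : \rank (map_mx (intmul 1 : int -> rat) B) = m.
  apply: mxrank_unit.
  by rewrite unitmxE det_map_mx unitfE intr_eq0.
rewrite BE -[#|S|.+1]addn1; apply: leq_trans (mxrank_add _ _) (leq_add _ _).
  by apply: leq_trans (mxrank_scale _ _) _; apply: mulmx_max_rank.
exact: mulmx_max_rank.
Qed.

Lemma leq_size_class (K : finFieldType) (V : vectType K) (a b k j : nat)
    (s : seq {vspace V}) :
  prime b -> coprime a b -> ~~ (b %| j) -> uniq s ->
  {in s, forall U, exists2 u, \dim U = b ^ k.+1 * u & u = j %[mod b]} ->
  {in s &, forall U W, U != W -> \dim (U :&: W)%VS * b = a * \dim U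
                              \/ \dim (U :&: W)%VS * b = a * \dim W} ->
  size s <= (qnum #|K| (\dim {:V})).+1.
Proof.
move=> b_pr cab bj us sdim sint; have b_gt0 := prime_gt0 b_pr.
have d_gt0 : 0 < b ^ k by rewrite expn_gt0 b_gt0.
have K_gt0 : 0 < #|K| := ltnW (finNzRing_gt1 K).
pose Q := #|K| ^ (b ^ k); have Q_gt0 : 0 < Q by rewrite expn_gt0 K_gt0.
pose N := qnum Q b; have N_gt1 : 1 < N := qnum_gt1 Q_gt0 (prime_gt1 b_pr).
pose F (i : 'I_(size s)) := nth 0%VS s i.
have Fs i : F i \in s by apply: mem_nth.
have int_dim i i' : i != i' ->
    exists2 x, \dim (F i :&: F i')%VS = b ^ k * x & x = a * j %[mod b].
  move=> ii'; have neF : F i != F i' by rewrite nth_uniq.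
  (* Whichever of the two members realises the ratio, its cofactor is [j] mod [b], so the residue
     [a * j] is the same for all pairs. *)
  have [U /sdim[u dU uj] dI] :
      exists2 U, U \in s & \dim (F i :&: F i')%VS * b = a * \dim U.
    by case: (sint _ _ (Fs i) (Fs i') neF); [exists (F i) | exists (F i')].
  exists (a * u); last by rewrite -modnMmr uj modnMmr.
  by apply/eqP; rewrite -(eqn_pmul2r b_gt0) dI dU expnSr -!mulnA mulnCA (mulnC b).
pose g i i' := qnum Q (\dim (F i :&: F i')%VS %/ b ^ k).
have p_pr : prime (pdiv N) by rewrite pdiv_prime.
rewrite -card_points.
apply: (@leq_card_inter_mod _ (points {:V}) _ (qnum #|K| (b ^ k)) (pdiv N)
          (qnum Q (a * j)) (fun i => points (F i)) g) => //.
- exact: qnum_gt0.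
(* Since [b] is prime to [a * j], $[b]_Q$ is prime to $[aj]_Q$, and [pdiv N] divides the former. *)
- rewrite -prime_coprime // (coprime_dvdl (pdiv_dvd N)) //.
  by rewrite coprime_qnum // coprimeMr coprime_sym cab prime_coprime.
- by move=> i; rewrite -(capvf (F i)) pointsI subsetIr.
- move=> i i'; rewrite -pointsI card_points -qnumM mulnC divnK //.
  have [<-|/int_dim[x -> _]] := eqVneq i i'; last exact: dvdn_mulr.
  by rewrite capvv; have [u -> _] := sdim _ (Fs i); rewrite expnSr -mulnA dvdn_mulr.
- move=> i; apply: (dvdn_trans (pdiv_dvd N)).
  rewrite /g capvv; have [u -> _] := sdim _ (Fs i).
  by rewrite expnSr -mulnA mulKn // dvdn_qnum // dvdn_mulr.
- move=> i i' /int_dim[x dI xE]; rewrite /g dI mulKn //.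
  by rewrite -(modn_dvdm _ (pdiv_dvd N)) (qnum_modn Q xE) modn_dvdm // pdiv_dvd.
Qed.

(** * Sorting the family into classes *)

Lemma leq_size_fibers (T : eqType) (f : T -> nat) (N c : nat) (s : seq T) :
  {in s, forall x, f x < N} ->
  (forall i, i < N -> size [seq x <- s | f x == i] <= c) -> size s <= N * c.
Proof.
elim: N s => [|N IHN] s fN fc.
  by case: s fN {fc} => // x s /(_ x (mem_head _ _)).
rewrite -(count_predC (fun x => f x == N) s) mulSn leq_add //.
  by rewrite -size_filter fc.
rewrite -size_filter; apply: IHN => [x|i iN].
  by rewrite mem_filter /= => /andP[xN /fN]; rewrite ltnS leq_eqVlt (negPf xN).
apply: leq_trans (fc i (leqW iN)); rewrite -filter_predI !size_filter.
by apply: sub_count => x /andP[].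
Qed.

Lemma leq_card_fractional_intersecting (K : finFieldType) (V : vectType K)
    (a b : nat) (Fam : {fset {vspace V}}) :
  0 < a -> coprime a b -> prime b ->
  fractional_intersecting (pred1 (a%:R / b%:R : rat)%R) Fam ->
  #|` Fam| <= trunc_log b (\dim {:V}) * (b.-1 * (qnum #|K| (\dim {:V})).+1) + 1.
Proof.
move=> a_gt0 cab b_pr FamI; have b_gt1 := prime_gt1 b_pr.
have ratioP (W U : {vspace V}) : (dim_ratio W U \in pred1 (a%:R / b%:R : rat)%R) ->
    0 < \dim U /\ \dim W * b = a * \dim U.
  rewrite inE /dim_ratio => /eqP E.
  have U0 : 0 < \dim U.
    (* A zero denominator would make the ratio 0, but [a / b] is nonzero. *)
    rewrite lt0n; apply/eqP => U0; move/eqP: E; rewrite U0 invr0 mulr0 eq_sym.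
    by rewrite mulf_eq0 invr_eq0 !pnatr_eq0 !gtn_eqF // ltnW.
  split=> //; apply/eqP; rewrite -(eqr_nat rat) !natrM -eqr_div ?E //;
    by rewrite pnatr_eq0 -lt0n // ltnW.
pose good (U : {vspace V}) := (0 < \dim U) && (b %| \dim U).
have ratio_good (W U : {vspace V}) :
    (dim_ratio W U \in pred1 (a%:R / b%:R : rat)%R) -> good U.
  (* From [\dim W * b = a * \dim U] with [b] prime to [a], [b] divides [\dim U]. *)
  case/ratioP => U0 E; rewrite /good U0 -(Gauss_dvdr _ (_ : coprime b a)) 1?coprime_sym //.
  by rewrite -E dvdn_mull.
pose s := enum_fset Fam; have us : uniq s := fset_uniq Fam.
rewrite -[#|` Fam|]/(size s) -(count_predC good s) leq_add //; last first.
  rewrite -size_filter; case E: [seq x <- s | _] => [|U [|W t]] //.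
  have: uniq [seq x <- s | predC good x] by rewrite filter_uniq.
  have UE x : x \in [:: U, W & t] -> (x \in Fam) && ~~ good x.
    by rewrite -E mem_filter andbC.
  have /andP[UF nU] : (U \in Fam) && ~~ good U by apply: UE; rewrite !inE eqxx.
  have /andP[WF nW] : (W \in Fam) && ~~ good W by apply: UE; rewrite !inE eqxx orbT.
  rewrite E /= inE negb_or => /andP[/andP[UW _] _].
  by case: (FamI _ _ UF WF UW) => /ratio_good; rewrite (negPf nU, negPf nW).
rewrite -size_filter; set s1 := [seq x <- s | good x].
have s1P U : U \in s1 -> [/\ U \in Fam, 0 < \dim U & b %| \dim U].
  by rewrite mem_filter => /andP[/andP[-> ->] ->].
have logP (U : {vspace V}) : 0 < \dim U -> \dim U = b ^ logn b (\dim U) * (\dim U)`_b^'.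
  by move=> U0; rewrite -p_part partnC.
have cof_ndvd (U : {vspace V}) : ~~ (b %| (\dim U)`_b^').
  by rewrite -prime_coprime // (pnat_coprime (pnat_id b_pr)) // part_pnat.
have log_gt0 U : U \in s1 -> 0 < logn b (\dim U).
  by case/s1P => _ U0 bU; rewrite logn_gt0 mem_primes b_pr U0.
(* Valuations of good members lie between 1 and [trunc_log b (\dim {:V})]; the predecessor starts
   the numbering at 0. *)
apply: (@leq_size_fibers _ (fun U => (logn b (\dim U)).-1)) => [U Us1|k _].
  rewrite prednK ?log_gt0 //; have [_ U0 _] := s1P _ Us1.
  apply: trunc_log_max => //; apply: leq_trans (dimvS (subvf U)).
  by rewrite dvdn_leq // pfactor_dvdnn.
(* The cofactor is prime to [b], so its residue is nonzero: [b.-1] values, again shifted to start at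
   0. *)
apply: (@leq_size_fibers _ (fun U : {vspace V} => ((\dim U)`_b^' %% b).-1)) => [U _|j _].
  have: 0 < (\dim U)`_b^' %% b by rewrite lt0n; apply: cof_ndvd.
  have: (\dim U)`_b^' %% b < b by rewrite ltn_mod ltnW.
  by case: (_ %% _) => // r rb _; rewrite /= -ltnS (ltn_predK b_gt1).
set s2 := filter _ _.
have s2P U : U \in s2 -> [/\ U \in s1, logn b (\dim U) = k.+1 & (\dim U)`_b^' %% b = j.+1].
  rewrite 2!mem_filter => /andP[/eqP jE /andP[/eqP kE Us1]]; split=> //.
    by rewrite -kE prednK // log_gt0.
  by rewrite -jE prednK // lt0n; apply: cof_ndvd.
(* A member of a nonempty class witnesses that [b] does not divide [j.+1]. *)
case: (posnP (size s2)) => [-> //|]; rewrite -has_predT => /hasP[U0 /s2P[_ _ U0j] _].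
apply: (@leq_size_class _ _ a b k j.+1) => //.
- by rewrite -U0j /dvdn modn_mod; apply: cof_ndvd.
- by rewrite !filter_uniq.
- move=> U /s2P[/s1P[_ Ugt0 _] kE jE]; exists (\dim U)`_b^'.
    by rewrite -kE -logP.
  by rewrite -jE modn_mod.
- move=> U W /s2P[/s1P[UF _ _] _ _] /s2P[/s1P[WF _ _] _ _] UW.
  by case: (FamI _ _ UF WF UW) => /ratioP[_]; [left | right].
Qed.

(** * Passage to the real bound *)

Local Open Scope ring_scope.

Lemma qbinom1E (R : realType) (q n : nat) :
  (1 < q)%N -> qbinom1 R q n = (qnum q n)%:R.
Proof.
move=> q_gt1; have q1 : (q%:R - 1 : R) != 0 by rewrite subr_eq0 pnatr_eq1 gtn_eqF.
rewrite /qbinom1 subrX1 mulrAC divff // mul1r natr_sum.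
by apply: eq_bigr => i _; rewrite natrX.
Qed.

Lemma trunc_log_le_ceil (R : realType) (b n : nat) : (1 < b)%N ->
  (trunc_log b n)%:R <= (Num.ceil (ln (n%:R : R) / ln (b%:R : R)))%:~R :> R.
Proof.
move=> b_gt1; have lnb : 0 < ln (b%:R : R) by rewrite ln_gt0 // ltr1n.
(* At [n = 0] both sides vanish, as [ln 0] is 0 by convention. *)
case: n => [|n]; first by rewrite trunc_log0 ln0 // mul0r ceil0.
apply: le_trans (ceil_ge _); rewrite ler_pdivlMr // mulr_natl -lnXn.
  by rewrite ler_ln ?posrE -?natrX ?ltr0n ?ler_nat ?trunc_logP // expn_gt0 ltnW.
by rewrite ltr0n ltnW.
Qed.

Theorem theorem1p4 (R : realType) (K : finFieldType) (V : vectType K)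
    (q n : nat) (hq : #|K| = q) (hn : \dim {:V} = n)
    (a b : nat) (ha : (0 < a)%N) (hab : (a < b)%N)
    (hirr : coprime a b) (hb : prime b)
    (Fam : {fset {vspace V}})
    (hFam : fractional_intersecting (pred1 (a%:R / b%:R : rat)) Fam) :
  (#|` Fam|%:R : R) <=
    (b%:R - 1) * (qbinom1 R q n + 1)
      * (Num.ceil (ln (n%:R : R) / ln (b%:R : R)))%:~R + 2.
Proof.
have q_gt1 : (1 < q)%N by rewrite -hq finNzRing_gt1.
have b_gt1 := prime_gt1 hb.
have := leq_card_fractional_intersecting ha hirr hb hFam.
rewrite hq hn -(ler_nat R) => /le_trans; apply.
(* The final 1 is weakened to 2; what remains is to compare the two logarithm factors. *)
rewrite natrD lerD ?ler1n // natrM mulrC natrM.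
rewrite qbinom1E // -natr1 -subn1 natrB ?(ltnW b_gt1) //.
rewrite ler_wpM2l ?trunc_log_le_ceil //.
by rewrite mulr_ge0 ?subr_ge0 ?ler1n ?natr1 // ltnW.
Qed.
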